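(* Let $(R,m)$ be a local ring of dimension $n$ and let $x_1,\dots,x_d\in m$ form an $R$-sequence. Let $\mathbf{x}$ be the ideal generated by $x_1,\dots,x_d$, let $\lambda$ be a zero-divisor and not a parameter on $R/\mathbf{x}$, and let $\Omega=\operatorname{Hom}_R(R/(\mathbf{x},\lambda),R/\mathbf{x})$. Let $\Omega'$ be the lift of $\Omega$ in $R$ via the surjection $R\to R/\mathbf{x}$. Let $K_\bullet=K_\bullet(\mathbf{x};R)$ and $L_\bullet$ denote the Koszul complex on $x_1,\dots,x_d$ and a minimal free resolution of $\Omega$ respectively, and let $\phi_\bullet:L_\bullet\to K_\bullet$ denote a lift of the inclusion $\Omega\hookrightarrow R/\mathbf{x}$. If at least one of $x_1,\dots,x_d$ is contained in $m\Omega'$, then $\phi_d(L_d)=R$.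
   Context: ''Local ring'' means Noetherian local ring. $\Omega$ is identified with the ideal $(\mathbf{x}:\lambda)/\mathbf{x}$ of $R/\mathbf{x}$ (the annihilator of $\lambda$ in $R/\mathbf{x}$), which gives the inclusion $\Omega\hookrightarrow R/\mathbf{x}$; $\Omega'$ is the preimage of this ideal in $R$. Here $K_d(\mathbf{x};R)=R$, so $\phi_d:L_d\to R$. *)

(* Defs.v *)
From HB Require Import structures.
From mathcomp Require Import all_boot all_algebra.
From mathcomp Require Import boolp classical_sets.

Set Implicit Arguments.
Unset Strict Implicit.
Unset Printing Implicit Defensive.

Import GRing.Theory.
Local Open Scope classical_set_scope.
Local Open Scope ring_scope.

Section Ideals.
Variable A : comPzRingType.
Implicit Types (I J p q m : set A) (s : seq A).

Definition is_ideal I : Prop :=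
  [/\ I 0, forall a b, I a -> I b -> I (a + b) & forall r a, I a -> I (r * a)].

Definition ideal_gen s : set A :=
  [set r | exists a : 'I_(size s) -> A, r = \sum_(i < size s) a i * s`_i].

Definition prime_ideal p : Prop :=
  [/\ is_ideal p, ~ p 1 & forall a b, p (a * b) -> p a \/ p b].

Definition maximal_ideal m : Prop :=
  [/\ is_ideal m, ~ m 1 &
      forall J, is_ideal J -> m `<=` J -> J = m \/ J = setT].

Definition radical I : set A := [set a | exists n : nat, I (a ^+ n)].

Definition primary_to m q : Prop :=
  [/\ is_ideal q, ~ q 1, forall a b, q (a * b) -> q a \/ radical q b
    & radical q = m].

Definition noetherian : Prop :=
  forall I, is_ideal I -> exists s, I = ideal_gen s.

Definition local_ring m : Prop :=
  [/\ noetherian, maximal_ideal m & forall m', maximal_ideal m' -> m' = m].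

(* strict chain P 0 < ... < P k of primes, of length k *)
Definition prime_chain (k : nat) (P : nat -> set A) : Prop :=
  (forall i, (i <= k)%N -> prime_ideal (P i)) /\
  (forall i, (i < k)%N -> P i `<` P i.+1).

Definition krull_dim (n : nat) : Prop :=
  (exists P, prime_chain n P) /\
  (forall k P, prime_chain k P -> (k <= n)%N).

(* systems of parameters and parameters, for A local with maximal ideal m *)
Definition system_of_parameters m (k : nat) (s : k.-tuple A) : Prop :=
  krull_dim k /\ primary_to m (ideal_gen s).

Definition parameter m (a : A) : Prop :=
  exists (k : nat) (s : k.-tuple A), system_of_parameters m s /\ a \in s.

End Ideals.
Arguments noetherian : clear implicits.
Arguments krull_dim : clear implicits.

(* The quotient of R by the ideal generated by s, as a ring and an R-module.
   {ideal_quot _} is not used because it requires a proof that the ideal is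
   proper. *)
Section RQuot.
Variables (R : comNzRingType) (s : seq R).
Local Open Scope quotient_scope.

Definition ideal_pred : {pred R} := fun r => `[< ideal_gen s r >].

Lemma ideal_predP r : reflect (ideal_gen s r) (r \in ideal_pred).
Proof. exact: asboolP. Qed.

Lemma ideal_gen_ideal : is_ideal (ideal_gen s).
Proof.
split; first by exists (fun=> 0); rewrite big1 // => i _; rewrite mul0r.
- move=> _ _ [a ->] [b ->]; exists (fun i => a i + b i).
  by rewrite -big_split; apply: eq_bigr => i _; rewrite mulrDl.
- move=> r _ [a ->]; exists (fun i => r * a i).
  by rewrite mulr_sumr; apply: eq_bigr => i _; rewrite mulrA.
Qed.

Lemma ideal_predM a r : r \in ideal_pred -> a * r \in ideal_pred.
Proof.
by move/ideal_predP=> h; apply/ideal_predP; case: ideal_gen_ideal => _ _; apply.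
Qed.

Lemma ideal_pred_zmod_closed : zmod_closed ideal_pred.
Proof.
have [h0 hD hM] := ideal_gen_ideal; split; first exact/ideal_predP.
move=> u v /ideal_predP hu /ideal_predP hv; apply/ideal_predP.
by rewrite -mulN1r; apply: hD => //; apply: hM.
Qed.

HB.instance Definition _ := GRing.isZmodClosed.Build R ideal_pred
  ideal_pred_zmod_closed.

Definition ideal_zmod : zmodClosed R := ideal_pred.

Definition rquot : Type := Quotient.quot ideal_zmod.
HB.instance Definition _ := GRing.Zmodule.on rquot.

Definition rpi : R -> rquot := fun r => \pi_(Quotient.quot ideal_zmod) r.
Definition rrepr : rquot -> R := fun q => repr (q : Quotient.quot ideal_zmod).

Lemma rreprK q : rpi (rrepr q) = q.
Proof. exact: reprK. Qed.

Lemma rpi_eq a b : rpi a = rpi b <-> ideal_gen s (a - b).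
Proof.
split; first by move/eqP; rewrite -Quotient.idealrBE => /ideal_predP.
by move/ideal_predP; rewrite Quotient.idealrBE => /eqP.
Qed.

Lemma rpi_zmod_morphism : zmod_morphism rpi.
Proof. by move=> a b; rewrite /rpi raddfB. Qed.
HB.instance Definition _ := GRing.isZmodMorphism.Build R rquot rpi
  rpi_zmod_morphism.

Definition rmul (p q : rquot) : rquot := rpi (rrepr p * rrepr q).
Definition rscale (a : R) (q : rquot) : rquot := rpi (a * rrepr q).

Lemma rscale_pi a b : rscale a (rpi b) = rpi (a * b).
Proof.
apply/rpi_eq; rewrite -mulrBr; have [_ _] := ideal_gen_ideal; apply.
by apply/rpi_eq; rewrite rreprK.
Qed.

Lemma rmul_pi a b : rmul (rpi a) (rpi b) = rpi (a * b).
Proof.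
rewrite -rscale_pi /rmul /rscale; apply/rpi_eq; rewrite -mulrBl mulrC.
have [_ _] := ideal_gen_ideal; apply.
by apply/rpi_eq; rewrite rreprK.
Qed.

Lemma rmulA : associative rmul.
Proof.
by move=> p q r; rewrite -[p]rreprK -[q]rreprK -[r]rreprK !rmul_pi mulrA.
Qed.

Lemma rmulC : commutative rmul.
Proof. by move=> p q; rewrite /rmul mulrC. Qed.

Lemma rmul1 : left_id (rpi 1) rmul.
Proof. by move=> p; rewrite -[p]rreprK rmul_pi mul1r. Qed.

Lemma rmulDl : left_distributive rmul +%R.
Proof.
move=> p q r; rewrite -[p]rreprK -[q]rreprK -[r]rreprK.
by rewrite !rmul_pi -!raddfD rmul_pi mulrDl.
Qed.

HB.instance Definition _ := GRing.Zmodule_isComPzRing.Build rquot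
  rmulA rmulC rmul1 rmulDl.

Lemma rscaleA a b q : rscale a (rscale b q) = rscale (a * b) q.
Proof. by rewrite -[q]rreprK !rscale_pi mulrA. Qed.

Lemma rscale1 : left_id 1 rscale.
Proof. by move=> q; rewrite -[q]rreprK rscale_pi mul1r. Qed.

Lemma rscaleDr : right_distributive rscale +%R.
Proof.
move=> a p q; rewrite -[p]rreprK -[q]rreprK.
by rewrite -raddfD !rscale_pi -raddfD mulrDr.
Qed.

Lemma rscaleDl q : {morph rscale^~ q : a b / a + b}.
Proof. by move=> a b; rewrite -[q]rreprK !rscale_pi -raddfD mulrDl. Qed.

HB.instance Definition _ := GRing.Zmodule_isLmodule.Build R rquot
  rscaleA rscale1 rscaleDr rscaleDl.

Lemma rpi_monoid_morphism : monoid_morphism rpi.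
Proof. by split=> // a b; rewrite -rmul_pi. Qed.
HB.instance Definition _ := GRing.isMonoidMorphism.Build R rquot rpi
  rpi_monoid_morphism.

Lemma scale_rpi a b : a *: rpi b = rpi (a * b).
Proof. exact: rscale_pi. Qed.

End RQuot.

(* Hom_R(U, V), as an R-module *)
Section Hom.
Variables (R : comNzRingType) (U V : lmodType R).

Definition Hom : Type := {linear U -> V}.
Definition hom_fun (f : Hom) : U -> V := f.
Coercion hom_fun : Hom >-> Funclass.
HB.instance Definition _ := gen_eqMixin Hom.
HB.instance Definition _ := gen_choiceMixin Hom.

Lemma homP (f g : Hom) : (forall u, f u = g u) -> f = g.
Proof.
case: f g => [f [[?] [?]]] [g [[?] [?]]] /= /funext efg.
rewrite /hom_fun /= in efg; subst g.
by congr (GRing.Linear.Pack (GRing.Linear.Class _ _));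
   congr (_ _); apply: Prop_irrelevance.
Qed.

Definition hom_of (f : U -> V) (lf : linear f) : Hom :=
  HB.pack_for {linear U -> V} f (GRing.isLinear.Build R U V *:%R f lf).

Lemma hom_linear (f : Hom) : linear f.
Proof. by move=> a u v; rewrite /hom_fun linearP. Qed.

Lemma hom0_subproof : linear (fun _ : U => 0 : V).
Proof. by move=> a u v; rewrite scaler0 addr0. Qed.
Lemma homD_subproof (f g : Hom) : linear (fun u => f u + g u).
Proof. by move=> a u v; rewrite !hom_linear scalerDr addrACA. Qed.
Lemma homN_subproof (f : Hom) : linear (fun u => - f u).
Proof. by move=> a u v; rewrite hom_linear opprD scalerN. Qed.
Lemma homZ_subproof (c : R) (f : Hom) : linear (fun u => c *: f u).
Proof.
by move=> a u v; rewrite hom_linear scalerDr !scalerA mulrC.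
Qed.

Definition hom0 := hom_of hom0_subproof.
Definition homD f g := hom_of (homD_subproof f g).
Definition homN f := hom_of (homN_subproof f).
Definition homZ c f := hom_of (homZ_subproof c f).

Lemma homDA : associative homD.
Proof. by move=> f g h; apply: homP => u; rewrite /hom_fun /= addrA. Qed.
Lemma homDC : commutative homD.
Proof. by move=> f g; apply: homP => u; rewrite /hom_fun /= addrC. Qed.
Lemma hom0D : left_id hom0 homD.
Proof. by move=> f; apply: homP => u; rewrite /hom_fun /= add0r. Qed.
Lemma homND : left_inverse hom0 homN homD.
Proof. by move=> f; apply: homP => u; rewrite /hom_fun /= addNr. Qed.
HB.instance Definition _ := GRing.isZmodule.Build Hom homDA homDC hom0D homND.

Lemma homZA a b f : homZ a (homZ b f) = homZ (a * b) f.
Proof. by apply: homP => u; rewrite /hom_fun /= scalerA. Qed.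
Lemma homZ1 : left_id 1 homZ.
Proof. by move=> f; apply: homP => u; rewrite /hom_fun /= scale1r. Qed.
Lemma homZDr : right_distributive homZ +%R.
Proof. by move=> a f g; apply: homP => u; rewrite /hom_fun /= scalerDr. Qed.
Lemma homZDl f : {morph homZ^~ f : a b / a + b}.
Proof. by move=> a b; apply: homP => u; rewrite /hom_fun /= scalerDl. Qed.
HB.instance Definition _ := GRing.Zmodule_isLmodule.Build R Hom
  homZA homZ1 homZDr homZDl.

End Hom.

Section Modules.
Variable R : comNzRingType.

(* the submodule I N of M *)
Definition mulset (M : lmodType R) (I : set R) (N : set M) : set M :=
  [set v | exists (k : nat) (a : 'I_k -> R) (u : 'I_k -> M),
     [/\ forall i, I (a i), forall i, N (u i) & v = \sum_i a i *: u i]].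

(* 0 is a zero-divisor on every nonzero module *)
Definition zero_divisor_on (M : lmodType R) (a : R) : Prop :=
  exists v : M, v <> 0 /\ a *: v = 0.

Definition regular_sequence (d : nat) (x : d.-tuple R) : Prop :=
  (forall i : 'I_d, ~ zero_divisor_on (rquot (take i x)) (tnth x i)) /\
  (1 : rquot x) <> 0.

Definition finite_free (M : lmodType R) : Prop :=
  exists (b : nat) (e : 'I_b -> M),
    forall v : M, exists! c : {ffun 'I_b -> R}, v = \sum_i c i *: e i.

Definition free_resolution (M : lmodType R) (L : nat -> lmodType R)
    (dL : forall i, {linear L i.+1 -> L i}) (eps : {linear L 0%N -> M}) : Prop :=
  [/\ forall i, finite_free (L i),
      forall w : M, exists v, eps v = w,
      forall v, eps v = 0 <-> exists u, dL 0%N u = v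
    & forall i v, dL i v = 0 <-> exists u, dL i.+1 u = v].

Definition minimal_free_resolution (m : set R) (M : lmodType R)
    (L : nat -> lmodType R) (dL : forall i, {linear L i.+1 -> L i})
    (eps : {linear L 0%N -> M}) : Prop :=
  free_resolution dL eps /\ forall i u, mulset m setT (dL i u).

End Modules.

(* Koszul complex: K_i is free on the e_I, for I a subset of {0, ..., d-1} of
   size i; an element is the family of its coefficients. *)
Section Koszul.
Local Close Scope classical_set_scope.
Local Open Scope set_scope.
Variables (R : comNzRingType) (d : nat) (x : d.-tuple R).

Definition kbasis (i : nat) : finType := {I : {set 'I_d} | #|I| == i}.

Definition koszul (i : nat) : lmodType R := {ffun kbasis i -> R^o}.

Definition kcoef (i : nat) (f : koszul i) (I : {set 'I_d}) : R :=
  if insub I is Some u then (f : {ffun kbasis i -> R^o}) u else 0.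

(* d(e_I) = \sum_(j in I) (-1)^#{k in I | k < j} x_j e_(I \ j), read off on
   the coefficient of e_J, which receives the terms with I = J + j, j \notin J *)
Definition kdiff (i : nat) (f : koszul i.+1) : koszul i :=
  [ffun J : kbasis i => \sum_(j < d | j \notin val J)
     (-1) ^+ #|[set k in val J | (k < j)%N]| * tnth x j * kcoef f (j |: val J)].

Definition kaug (f : koszul 0) : rquot x := rpi x (kcoef f finset.set0).

(* the identification of K_d with R, through the basis element e_{0,...,d-1} *)
Definition ktop (f : koszul d) : R := kcoef f [set: 'I_d].

End Koszul.

Section Omega.
Variables (R : comNzRingType) (d : nat) (x : d.-tuple R) (lam : R).

Definition Omega : lmodType R := Hom (rquot (rcons x lam)) (rquot x).

(* Evaluation at 1 identifies Omega with the annihilator (x : lam) / x of lam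
   in R / x; see lift_OmegaE. *)
Definition Omega_incl (f : Omega) : rquot x :=
  (f : Hom _ _) (rpi (rcons x lam) 1).

Definition lift_Omega : set R :=
  [set r | exists f : Omega, Omega_incl f = rpi x r].

Lemma lift_OmegaE r : lift_Omega r <-> ideal_gen x (lam * r).
Proof.
have memx s (y : R) : y \in s -> ideal_gen s y.
  move=> ys; have lt_ys : (index y s < size s)%N by rewrite index_mem.
  exists (fun i => (i == Ordinal lt_ys)%:R).
  rewrite (bigD1 (Ordinal lt_ys)) //= eqxx mul1r nth_index // big1 ?addr0 //.
  by move=> i /negbTE->; rewrite mul0r.
have rpi0 s (y : R) : rpi s y = 0 <-> ideal_gen s y.
  by rewrite -(raddf0 (rpi s)) rpi_eq subr0.
split=> [[f fr]|xlr].
  apply/rpi0; rewrite -scale_rpi -fr /Omega_incl -[_ *: _]addr0.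
  rewrite -[0 in X in _ + X](subrr (hom_fun f 0)) addrA -(hom_linear (f : Hom _ _)) addr0 scale_rpi mulr1.
  rewrite (_ : rpi _ lam = 0); last first.
    by apply/rpi0/memx; rewrite mem_rcons mem_head.
  exact: subrr.
have gP a b : rpi (rcons x lam) a = rpi (rcons x lam) b ->
    rpi x (a * r) = rpi x (b * r).
  move/rpi_eq=> [c abE]; apply/rpi_eq; rewrite -mulrBl abE mulr_suml.
  have [h0 hD hM] := ideal_gen_ideal x.
  apply: (big_ind (ideal_gen x)) => // i _; rewrite -mulrA; apply: (hM).
  have := mem_nth 0 (ltn_ord i); rewrite mem_rcons inE => /predU1P[->//|/memx].
  by rewrite mulrC; apply: hM.
have gl : linear (fun q : rquot (rcons x lam) => rpi x (rrepr q * r)).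
  move=> a p q; rewrite scale_rpi -raddfD mulrA -mulrDl; apply: gP.
  by rewrite [RHS](raddfD (rpi _)) /= -scale_rpi !rreprK.
exists (hom_of gl); rewrite /Omega_incl /hom_fun /=.
by rewrite (gP _ 1) ?rreprK ?mul1r.
Qed.

Definition lifts_inclusion (L : nat -> lmodType R)
    (dL : forall i, {linear L i.+1 -> L i}) (eps : {linear L 0%N -> Omega})
    (phi : forall i, {linear L i -> koszul R d i}) : Prop :=
  (forall i u, phi i (dL i u) = kdiff x (phi i.+1 u)) /\
  (forall u, kaug x (phi 0%N u) = Omega_incl (eps u)).

End Omega.

(* Main.v *)
Require Import Defs.
From HB Require Import structures.
From mathcomp Require Import all_boot all_algebra.
From mathcomp Require Import ring.
From mathcomp Require Import boolp classical_sets.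

Set Implicit Arguments.
Unset Strict Implicit.
Unset Printing Implicit Defensive.

Import GRing.Theory.
Local Open Scope ring_scope.

(** The inclusion Omega -> R/x has cokernel R/Omega', so the mapping cone C of
    phi : L -> K is a resolution of R/Omega', where K is the Koszul complex
    (exact since x is regular).  Write x_p = \sum_i a_i u_i with a_i in m and
    u_i in Omega'.  Each u_i kills R/Omega', so u_i = D s_i + s_i d for some
    s_i : K -> C of degree 1, and with s := \sum_i a_i s_i the map
    t := e_p /\ - - s satisfies D t + t d = 0.  Lifting again through the exact
    complex C gives h with t = D h - h d.  Evaluate at the e_J with J the
    complement of p, and read off the top Koszul coefficient: s(e_J) and
    h(d e_J) contribute elements of m, while D h(e_J) contributes a value of
    phi_d, as K vanishes above degree d.  So phi_d(L_d) contains a unit. *)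

(** * Finitely generated ideals *)

Section IdealGen.
Variable A : comPzRingType.
Implicit Types (I : set A) (s : seq A).

Lemma ideal_gen_min s I r :
  is_ideal I -> (forall y, y \in s -> I y) -> ideal_gen s r -> I r.
Proof.
move=> [I0 ID IM] sI [a ->]; apply: (big_ind I) => // i _; apply: IM.
exact/sI/mem_nth.
Qed.

End IdealGen.

Lemma mem_ideal_gen (R : comNzRingType) (s : seq R) y :
  y \in s -> ideal_gen s y.
Proof.
move=> ys; have lt_ys : (index y s < size s)%N by rewrite index_mem.
exists (fun i => (i == Ordinal lt_ys)%:R).
rewrite (bigD1 (Ordinal lt_ys)) //= eqxx mul1r nth_index // big1 ?addr0 //.
by move=> i /negbTE->; rewrite mul0r.
Qed.

(** Splits off the last generator, as the induction along a regular sequence adds one element at a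
    time. *)
Lemma ideal_gen_rcons (R : comNzRingType) (s : seq R) y r :
  ideal_gen (rcons s y) r -> exists c, ideal_gen s (r - y * c).
Proof.
have [s0 sD sM] := ideal_gen_ideal s.
apply: (@ideal_gen_min _ (rcons s y)
  (fun r => exists c, ideal_gen s (r - y * c))).
  split=> [|a b [c ac] [e be]|t a [c ac]].
  - by exists 0; rewrite mulr0 subr0.
  - by exists (c + e); rewrite mulrDr opprD addrACA; apply: sD.
  - by exists (t * c); rewrite mulrCA -mulrBr; apply: sM.
move=> z; rewrite mem_rcons inE => /predU1P[->|zs].
  by exists 1; rewrite mulr1 subrr.
by exists 0; rewrite mulr0 subr0; apply: mem_ideal_gen.
Qed.

Lemma rpi_eq0 (R : comNzRingType) (s : seq R) r :
  rpi s r = 0 <-> ideal_gen s r.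
Proof. by rewrite -(raddf0 (rpi s)) rpi_eq subr0. Qed.

(** * Maximal ideals and units of a local ring *)

Section LocalRing.
Local Open Scope classical_set_scope.
Variables (A : comPzRingType) (m : set A).

(** Zorn's lemma, applied to the ideals that contain u and avoid 1. *)
Lemma sub_maximal_ideal (u : A) :
  (forall r, r * u <> 1) -> exists2 M, maximal_ideal M & M u.
Proof.
move=> nu.
(* P holds of the empty set, so that the empty chain has an upper bound. *)
pose P (I : set A) := [/\ forall a b, I a -> I b -> I (a + b),
  forall r a, I a -> I (r * a), ~ I 1 & forall a, I a -> I u].
have [F FP Ftot|M [[MD MM M1 Mu] Mmax]] := @Zorn_bigcup A P.
  split=> [a b [X FX Xa] [Y FY Yb]|r a [X FX Xa]|[X FX X1]|a [X FX Xa]].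
  - case: (Ftot X Y FX FY) => sXY.
      by exists Y => //; have [hD _ _ _] := FP _ FY; apply: hD => //; apply: sXY.
    by exists X => //; have [hD _ _ _] := FP _ FX; apply: hD => //; apply: sXY.
  - by exists X => //; have [_ hM _ _] := FP _ FX; apply: hM.
  - by have [_ _ + _] := FP _ FX.
  - by exists X => //; have [_ _ _ h] := FP _ FX; apply: h Xa.
(* If M missed u it would be empty, and the principal ideal of u, proper since u is no unit, would
   be strictly larger. *)
have {}Mu : M u.
  apply: contrapT => Mu'.
  have M0 : M = set0.
    by apply/seteqP; split=> // a Ma; apply: Mu'; apply: Mu Ma.
  apply: (Mmax [set r | exists s, r = s * u]).
    by rewrite M0; split=> // /(_ u); apply; exists 1; rewrite mul1r.
  split=> [_ _ [s ->] [t ->]|r _ [s ->]|[s /esym]|_ _].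
  - by exists (s + t); rewrite mulrDl.
  - by exists (r * s); rewrite mulrA.
  - exact: nu.
  - by exists 1; rewrite mul1r.
exists M => //; split=> //.
  by split=> //; rewrite -(mul0r u); apply: MM.
move=> J [J0 JD JM] sMJ.
have [J1|nJ1] := pselect (J 1).
  by right; apply/seteqP; split=> // a _; rewrite -(mulr1 a); apply: JM.
left; apply: contrapT => JMn; apply: (Mmax J).
  by rewrite properEneq; split=> //; apply/eqP => /esym.
by split=> // a _; apply: sMJ.
Qed.

Lemma local_ring_unit (u : A) :
  local_ring m -> ~ m u -> exists r, r * u = 1.
Proof.
move=> [_ _ mE] mu; apply: contrapT => nu.
have [M Mmax Mu] : exists2 M, maximal_ideal M & M u.
  by apply: sub_maximal_ideal => r ru; apply: nu; exists r.
by apply: mu; rewrite -(mE M).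
Qed.

End LocalRing.

(** * Signs of the exterior algebra *)

Section KoszulSigns.
Local Open Scope set_scope.
Variables (R : comNzRingType) (d : nat).
Implicit Types (J : {set 'I_d}) (j k : 'I_d).

(** The sign of sorting e_j into e_J: for j outside J, e_j /\ e_J is this sign times the basis
    element of [j |: J]. *)
Definition ksign J j : R := (-1) ^+ #|[set k in J | (k < j)%N]|.

Lemma ksignU1 J k j :
  k \notin J -> ksign (k |: J) j = (-1) ^+ (k < j)%N * ksign J j.
Proof.
move=> kJ; rewrite /ksign -exprD; congr (_ ^+ _).
have [kj|jk] /= := boolP (k < j)%N.
  rewrite (_ : [set _ in _ | _] = k |: [set i in J | (i < j)%N]).
    by rewrite cardsU1 inE (negbTE kJ).
  by apply/finset.setP=> i; rewrite !inE; case: eqP => [->|].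
rewrite add0n; apply: eq_card => i; rewrite !inE.
by case: eqP => // ->; rewrite (negbTE kJ) (negbTE jk).
Qed.

Lemma ksignU1id J j : j \notin J -> ksign (j |: J) j = ksign J j.
Proof. by move=> jJ; rewrite ksignU1 // ltnn mul1r. Qed.

Lemma ksignD1 J k j :
  k \in J -> ksign (J :\ k) j = (-1) ^+ (k < j)%N * ksign J j.
Proof.
move=> kJ; rewrite -{2}(finset.setD1K kJ) ksignU1 ?finset.setD11 //.
by rewrite mulrA -exprD addnn -signr_odd odd_double mul1r.
Qed.

Lemma ksign_sqr J j : ksign J j * ksign J j = 1.
Proof. by rewrite -exprD addnn -signr_odd odd_double. Qed.

End KoszulSigns.

(** * The Koszul boundary on families, and construction of homotopies *)

Section KoszulBoundary.
Local Open Scope set_scope.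
Variables (R : comNzRingType) (d : nat) (x : d.-tuple R).
Implicit Types (J : {set 'I_d}) (j k : 'I_d).

(* A family h is read as the linear map e_J |-> h J on the Koszul complex;
   kbd h is then its composite with the Koszul differential. *)
Definition kbd (V : lmodType R) (h : {set 'I_d} -> V) J : V :=
  \sum_(j in J) (ksign R J j * tnth x j) *: h (J :\ j).

Lemma eq_kbd (V : lmodType R) (g h : {set 'I_d} -> V) J :
  (forall j, j \in J -> g (J :\ j) = h (J :\ j)) -> kbd g J = kbd h J.
Proof. by move=> gh; apply: eq_bigr => j jJ; rewrite gh. Qed.

Lemma linear_kbd (V W : lmodType R) (f : {linear V -> W}) h J :
  f (kbd h J) = kbd (f \o h) J.
Proof. by rewrite linear_sum; apply: eq_bigr => j _; rewrite linearZ. Qed.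

Lemma kbdD (V : lmodType R) (g h : {set 'I_d} -> V) J :
  kbd (fun I => g I + h I) J = kbd g J + kbd h J.
Proof. by rewrite -big_split; apply: eq_bigr => j _; rewrite scalerDr. Qed.

Lemma kbdZ (V : lmodType R) (h : {set 'I_d} -> V) a J :
  kbd (fun I => a *: h I) J = a *: kbd h J.
Proof.
by rewrite scaler_sumr; apply: eq_bigr => j _; rewrite !scalerA mulrC.
Qed.

Lemma kbd_sum (V : lmodType R) (I : finType) (h : I -> {set 'I_d} -> V) J :
  kbd (fun K => \sum_i h i K) J = \sum_i kbd (h i) J.
Proof.
by rewrite exchange_big; apply: eq_bigr => j _; rewrite scaler_sumr.
Qed.

(** Deleting j and k in either order gives the same set with opposite signs, since only the deletion
    of the smaller index changes the sign of the other. The half of the double sum with j < k is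
    exchanged against the half with k < j. *)
Lemma kbd_kbd (V : lmodType R) (h : {set 'I_d} -> V) J : kbd (kbd h) J = 0.
Proof.
pose F j k := (ksign R J j * tnth x j * (ksign R (J :\ j) k * tnth x k)) *:
  h (J :\ j :\ k).
have Fanti j k : j \in J -> k \in J -> (k < j)%N -> F k j = - F j k.
  move=> jJ kJ kj; rewrite /F !ksignD1 // kj ltnNge (ltnW kj) /= -scaleNr.
  rewrite [J :\ k :\ j]finset.setDDl finset.setUC -finset.setDDl; congr (_ *: _).
  by rewrite expr1 expr0; ring.
rewrite (_ : kbd _ _ = \sum_(j in J) \sum_(k in J | k != j) F j k); last first.
  apply: eq_bigr => j jJ; rewrite scaler_sumr; apply: eq_big => [k|k _].
    by rewrite !inE andbC.
  by rewrite scalerA.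
have split_sum j : \sum_(k in J | k != j) F j k =
    \sum_(k in J | (k < j)%N) F j k + \sum_(k in J | (j < k)%N) F j k.
  rewrite (bigID (fun k : 'I_d => (k < j)%N)) /=; congr (_ + _).
    apply: eq_bigl => k; rewrite -andbA; congr (_ && _).
    by rewrite -val_eqE /= neq_ltn; case: ltngtP.
  apply: eq_bigl => k; rewrite -andbA; congr (_ && _).
  by rewrite -val_eqE /= neq_ltn; case: ltngtP.
under eq_bigr => j _ do rewrite split_sum.
rewrite big_split /= [X in _ + X](exchange_big_dep (mem J)) /=; last first.
  by move=> j k _ /andP[].
rewrite -big_split big1 //= => j jJ.
rewrite [X in _ + X](_ : _ = \sum_(k in J | (k < j)%N) - F j k).
  by rewrite sumrN subrr.
by apply: eq_big => k /=; rewrite jJ // => /andP[kJ kj]; apply: Fanti.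
Qed.

(** With [h] built on the sets smaller than J, the right-hand side at J is a cycle: D sends it to s
    (g d - (g - s h d) d) e_J = s^2 h d d e_J = 0. Exactness on P then gives a value at J, and Q on
    the values keeps the next right-hand sides in P. The case s = 1 is for chain maps, s = -1 for
    maps that anticommute with the differentials. *)
Lemma kbd_homotopy (V : lmodType R) (D : {linear V -> V}) (P Q : V -> Prop)
    (s : R) (g : {set 'I_d} -> V) :
  Q 0 -> (forall v, P v -> D v = 0 -> exists2 w, Q w & D w = v) ->
  (forall h J, (forall I, Q (h I)) -> P (g J - s *: kbd h J)) ->
  (forall J, D (g J) = s *: kbd g J) ->
  exists2 h, forall J, Q (h J) & forall J, D (h J) = g J - s *: kbd h J.
Proof.
move=> Q0 exD PQ gD.
suff [h hQ hD] : exists2 h, forall J, Q (h J) &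
    forall J, (#|J| < d.+1)%N -> D (h J) = g J - s *: kbd h J.
  exists h => // J; apply: hD; rewrite ltnS; have := max_card (mem J).
  by rewrite card_ord.
elim: d.+1 => [|N [h hQ hD]]; first by exists (fun=> 0).
(* Only the values on sets of size N are replaced; [kbd h] at such a set reads [h] on smaller sets
   alone. *)
have /choice[h' h'P] J : exists w, Q w /\
    if #|J| == N then D w = g J - s *: kbd h J else w = h J.
  case: eqP => [cJ|_]; last by exists (h J).
  have [||w Qw Dw] := exD (g J - s *: kbd h J); first exact: PQ.
    rewrite linearB linearZ /= gD (linear_kbd D) -scalerBr.
    rewrite (@eq_kbd _ (D \o h) (fun I => g I + - s *: kbd h I)); last first.
      move=> j jJ; rewrite /= hD ?scaleNr //.
      by rewrite -cJ [X in (_ < X)%N](cardsD1 j) jJ.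
    by rewrite kbdD kbdZ kbd_kbd scaler0 addr0 subrr scaler0.
  by exists w.
have h'h (I : {set 'I_d}) : (#|I| < N)%N -> h' I = h I.
  by move=> cI; have [_] := h'P I; rewrite ltn_eqF.
exists h' => J; first by have [] := h'P J.
move=> cJ.
rewrite (@eq_kbd _ h' h); last first.
  move=> j jJ; apply: h'h; rewrite -ltnS; apply: leq_trans cJ.
  by rewrite ltnS [X in (_ < X)%N](cardsD1 j) jJ.
have [_] := h'P J; case: eqP => [//|cJN ->]; apply: hD.
by rewrite ltn_neqAle -ltnS cJ andbT; apply/eqP.
Qed.

End KoszulBoundary.

(** * The ungraded Koszul complex and exterior multiplication *)

Section TotalKoszul.
Local Open Scope set_scope.
Variables (R : comNzRingType) (d : nat) (x : d.-tuple R).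
Implicit Types (I J : {set 'I_d}) (j k p : 'I_d).

(* The Koszul complex as a single ungraded module with a square-zero
   endomorphism. *)
Definition kalg : lmodType R := {ffun {set 'I_d} -> R^o}.

Definition kalg_coef J (f : kalg) : R := (f : {ffun {set 'I_d} -> R^o}) J.

Definition kalg_of (f : {set 'I_d} -> R) : kalg := [ffun J => f J : R^o].

Lemma kalg_ofE f J : kalg_coef J (kalg_of f) = f J.
Proof. by rewrite /kalg_coef ffunE. Qed.

Lemma kalgP (f g : kalg) : (forall J, kalg_coef J f = kalg_coef J g) -> f = g.
Proof. by move=> fg; apply/ffunP => J; apply: fg. Qed.

Lemma kalg_coef_is_scalar J : scalar (kalg_coef J).
Proof. by move=> a f g; rewrite /kalg_coef !ffunE. Qed.
HB.instance Definition _ J := GRing.isLinear.Build R kalg R *%R (kalg_coef J)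
  (kalg_coef_is_scalar J).

Lemma kalg_coefD f g J : kalg_coef J (f + g) = kalg_coef J f + kalg_coef J g.
Proof. exact: (raddfD (kalg_coef J)). Qed.
Lemma kalg_coefB f g J : kalg_coef J (f - g) = kalg_coef J f - kalg_coef J g.
Proof. exact: (raddfB (kalg_coef J)). Qed.
Lemma kalg_coefZ a f J : kalg_coef J (a *: f) = a * kalg_coef J f.
Proof. by rewrite linearZ. Qed.
Lemma kalg_coef0 J : kalg_coef J 0 = 0.
Proof. exact: (raddf0 (kalg_coef J)). Qed.
Lemma kalg_coef_sum (T : Type) (r : seq T) (P : pred T) (F : T -> kalg) J :
  kalg_coef J (\sum_(i <- r | P i) F i) = \sum_(i <- r | P i) kalg_coef J (F i).
Proof. exact: (raddf_sum (kalg_coef J)). Qed.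

Definition kd (f : kalg) : kalg := kalg_of (fun J =>
  \sum_(j | j \notin J) ksign R J j * tnth x j * kalg_coef (j |: J) f).

Lemma kdE f J : kalg_coef J (kd f) =
  \sum_(j | j \notin J) ksign R J j * tnth x j * kalg_coef (j |: J) f.
Proof. exact: kalg_ofE. Qed.

Lemma kd_is_linear : linear kd.
Proof.
move=> a f g; apply: kalgP => J; rewrite kalg_coefD kalg_coefZ !kdE mulr_sumr.
rewrite -big_split; apply: eq_bigr => j _ /=.
by rewrite kalg_coefD kalg_coefZ; ring.
Qed.
HB.instance Definition _ := GRing.isLinear.Build R kalg kalg *:%R kd
  kd_is_linear.

Definition kdelta I : kalg := kalg_of (fun J => (J == I)%:R).

Lemma kdeltaE I J : kalg_coef J (kdelta I) = (J == I)%:R.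
Proof. exact: kalg_ofE. Qed.

Lemma kalg_decomp (f : kalg) : f = \sum_I kalg_coef I f *: kdelta I.
Proof.
apply: kalgP => J; rewrite kalg_coef_sum (bigD1 J) //= kalg_coefZ kdeltaE eqxx.
rewrite mulr1 big1 ?addr0 // => I /negbTE IJ.
by rewrite kalg_coefZ kdeltaE eq_sym IJ mulr0.
Qed.

(** [kd] is written on coefficients; on basis elements it is the usual boundary, which ties it to
    [kbd]. *)
Lemma kd_kdelta I : kd (kdelta I) = kbd x kdelta I.
Proof.
apply: kalgP => J; rewrite kdE /kbd kalg_coef_sum big_mkcond [RHS]big_mkcond.
apply: eq_bigr => j _; rewrite kalg_coefZ !kdeltaE.
have [jJ|jJ] /= := boolP (j \in J).
  by case: ifP => // jI; case: eqP jJ => [->|]; rewrite ?setD11 ?mulr0.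
case: ifP => jI.
  have -> : (j |: J == I) = (J == I :\ j).
    by apply/eqP/eqP => [<-|->]; rewrite ?setU1K ?finset.setD1K.
  by case: eqP => [->|]; rewrite ?mulr0 // ksignD1 // ltnn mul1r.
case: eqP => [jJI|]; rewrite ?mulr0 //.
by rewrite -jJI setU11 in jI.
Qed.

Lemma kd_kd (f : kalg) : kd (kd f) = 0.
Proof.
rewrite [f]kalg_decomp !linear_sum big1 // => I _.
rewrite !linearZ /= kd_kdelta linear_kbd (@eq_kbd _ _ _ _ _ (kbd x kdelta)).
  by rewrite kbd_kbd scaler0.
by move=> j _; rewrite /= kd_kdelta.
Qed.

Lemma kd_kdelta0 : kd (kdelta finset.set0) = 0.
Proof. by rewrite kd_kdelta /kbd big_set0. Qed.

(* exterior multiplication by the basis element e_p *)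
Definition kwedge p J : kalg :=
  if p \in J then 0 else ksign R J p *: kdelta (p |: J).

(** The identity d (e_p /\ z) + e_p /\ d z = x_p z at z = e_J. If p lies in J, only the deletion of
    p survives; otherwise deleting p from [p |: J] gives x_p e_J and the other terms cancel in
    pairs. *)
Lemma kd_kwedge p J :
  kd (kwedge p J) + kbd x (kwedge p) J = tnth x p *: kdelta J.
Proof.
rewrite /kwedge; case: ifP => [pJ|/negbT pJ].
  rewrite linear0 add0r /kbd (bigD1 p) //= setD11 finset.setD1K // big1 => [|j].
    rewrite addr0 scalerA ksignD1 // ltnn mul1r mulrAC ksign_sqr mul1r //.
  by case/andP=> _ jp; rewrite !inE eq_sym jp pJ scaler0.
rewrite linearZ /= kd_kdelta /kbd big_setU1 //= setU1K // scalerDr.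
rewrite scalerA ksignU1id // mulrA ksign_sqr mul1r -addrA.
rewrite scaler_sumr -big_split big1 ?addr0 //= => j jJ.
have pj : p != j by apply: contraNneq pJ => ->.
rewrite !inE pj (negbTE pJ) /= !scalerA ksignU1 // ksignD1 //.
have -> : (p |: J) :\ j = p |: J :\ j.
  by apply/finset.setP => i; rewrite !inE; case: (i =P p) => [->|] //; rewrite pj.
rewrite -scalerDl.
(* Exactly one of the two signs flips, so the two terms cancel in either order of p and j. *)
have [pj'|pj'] : (p < j)%N /\ (j < p)%N = false \/
    (p < j)%N = false /\ (j < p)%N.
  by move: pj; rewrite -val_eqE /=; case: ltngtP; [left|right|].
all: case: pj' => -> ->; rewrite expr1 expr0.
all: by rewrite [X in X *: _](_ : _ = 0) ?scale0r //; ring.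
Qed.

End TotalKoszul.

(** * Exactness of the Koszul complex of a regular sequence *)

Section KoszulExact.
Local Open Scope set_scope.
Variables (R : comNzRingType) (d : nat) (x : d.-tuple R).
Implicit Types (I J : {set 'I_d}) (j p : 'I_d).

(** The elements built from the e_j with j < k: the Koszul complex of the first k entries inside
    that of x. *)
Definition ksupp k (z : kalg R d) : Prop :=
  forall J j, j \in J -> (k <= j)%N -> kalg_coef J z = 0.

(** Induction on k, splitting z by its last variable e_p: the part b along e_p is a cycle in fewer
    variables, hence some d c, and subtracting d of c times e_p removes e_p from z. The condition at
    the empty set says that z vanishes in H_0 = R / (x_1, ..., x_k). *)
Lemma koszul_exact k (z : kalg R d) :
  (forall i : 'I_d, ~ zero_divisor_on (rquot (take i x)) (tnth x i)) ->
  (k <= d)%N -> ksupp k z -> kd x z = 0 ->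
  ideal_gen (take k x) (kalg_coef finset.set0 z) ->
  exists2 y, ksupp k y & kd x y = z.
Proof.
move=> xreg; elim: k z => [|k IHk] z kd_le z_supp dz z0.
  exists 0; first by move=> J j _ _; rewrite kalg_coef0.
  rewrite linear0; apply: kalgP => J; rewrite kalg_coef0.
  have [->|[j jJ]] := finset.set_0Vmem J; last by rewrite (z_supp _ _ jJ).
  by move: z0; rewrite take0 => -[a ->]; rewrite big1 // => -[].
pose p := Ordinal kd_le.
have take_p : take k.+1 x = rcons (take k x) (tnth x p).
  by rewrite (take_nth 0) ?size_tuple // (tnth_nth 0).
have [i0 iD iM] := ideal_gen_ideal (take k x).
have ltk j : j != p -> (k <= j)%N -> (k < j)%N.
  by move=> jp kj; rewrite ltn_neqAle kj andbT eq_sym.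
have signp J j : p \notin J -> (j < k)%N -> ksign R (p |: J) j = ksign R J j.
  by move=> pJ jk; rewrite ksignU1 //= ltnNge (ltnW jk) mul1r.
pose b : kalg R d :=
  kalg_of (fun J => if p \in J then 0 else kalg_coef (p |: J) z).
have b_supp : ksupp k b.
  move=> J j jJ kj; rewrite kalg_ofE; case: ifP => // pJ.
  apply: (z_supp _ j); first by rewrite !inE jJ orbT.
  by apply: ltk => //; apply: contraFneq pJ => <-.
have db : kd x b = 0.
  apply: kalgP => J; rewrite kalg_coef0 kdE.
  have [pJ|pJ] := boolP (p \in J).
    by rewrite big1 // => j _; rewrite kalg_ofE !inE pJ orbT mulr0.
  have := congr1 (kalg_coef (p |: J)) dz; rewrite kalg_coef0 kdE => dzJ.
  rewrite -[RHS]dzJ [LHS](bigID (fun j => j == p)) /= [X in X + _]big1 ?add0r.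
    apply: eq_big => [j|j /andP[jJ jp]]; first by rewrite !inE negb_or andbC.
    rewrite kalg_ofE !inE eq_sym (negbTE jp) (negbTE pJ) /=.
    rewrite finset.setUCA; have [jk|kj] := ltnP j k; first by rewrite signp.
    by rewrite [kalg_coef _ z](z_supp _ j) ?mulr0 ?ltk // !inE eqxx.
  by move=> j /andP[_ /eqP->]; rewrite kalg_ofE !inE eqxx mulr0.
(* The coefficient of d z at the empty set puts x_p z_{p} in the ideal of the earlier entries, and
   x_p is no zero-divisor modulo it. *)
have b0 : ideal_gen (take k x) (kalg_coef finset.set0 b).
  rewrite kalg_ofE inE finset.setU0.
  apply/rpi_eq0; apply: contrapT => zp0; apply: (xreg p).
  exists (rpi (take k x) (kalg_coef [set p] z)); split => //.
  rewrite scale_rpi; apply/rpi_eq0.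
  have := congr1 (kalg_coef finset.set0) dz; rewrite kalg_coef0 kdE.
  rewrite (bigD1 p) ?inE //= => /eqP; rewrite addr_eq0 => /eqP dz0.
  have -> : tnth x p * kalg_coef [set p] z =
      \sum_(j | (j \notin finset.set0) && (j != p)) - ksign R finset.set0 p *
        (ksign R finset.set0 j * kalg_coef (j |: finset.set0) z) * tnth x j.
    rewrite -[LHS]mul1r -(ksign_sqr R finset.set0 p) -!mulrA.
    rewrite (mulrA (ksign _ _ _) (tnth _ _)) -{1}(finset.setU0 [set p]) dz0.
    rewrite mulrN -mulNr mulr_sumr; apply: eq_bigr => j _; ring.
  apply: (big_ind (ideal_gen (take k x))) => // j /andP[_ jp].
  have [jk|kj] := ltnP j k.
    apply: iM; apply: mem_ideal_gen; rewrite (tnth_nth 0).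
    by rewrite -(nth_take 0 jk) mem_nth // size_take size_tuple kd_le.
  rewrite (z_supp _ j) ?ltk ?mulr0 ?mul0r //; first by rewrite !inE eqxx.
have [c c_supp dc] := IHk b (ltnW kd_le) b_supp db b0.
have [s zs] : exists s, ideal_gen (take k x)
    (kalg_coef finset.set0 z - tnth x p * s).
  by apply: ideal_gen_rcons; rewrite -take_p.
(* e_set0 is a cycle, so the degree 0 coefficient of c is free; this value
   makes the remainder below a boundary. *)
pose c' := c + (s - kalg_coef finset.set0 c) *: kdelta R finset.set0.
have c'0 : kalg_coef finset.set0 c' = s.
  by rewrite kalg_coefD kalg_coefZ kdeltaE eqxx mulr1 addrC subrK.
have dc' : kd x c' = b by rewrite linearD linearZ /= kd_kdelta0 scaler0 addr0.
have c'_supp : ksupp k c'.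
  move=> J j jJ kj; rewrite kalg_coefD (c_supp _ _ jJ kj) add0r kalg_coefZ.
  by rewrite kdeltaE; case: eqP jJ => [->|]; rewrite ?inE ?mulr0.
(* [w] is [c'] multiplied by e_p on the right; as p is the largest index in play, no sign enters. *)
pose w : kalg R d :=
  kalg_of (fun J => if p \in J then kalg_coef (J :\ p) c' else 0).
have w_supp : ksupp k.+1 w.
  move=> J j jJ kj; rewrite kalg_ofE; case: ifP => // pJ.
  apply: (c'_supp _ j); last exact: ltnW.
  rewrite !inE jJ andbT; apply/eqP => jp.
  by rewrite jp /= ltnn in kj.
have dw J : p \in J -> kalg_coef J (kd x w) = kalg_coef J z.
  move=> pJ; rewrite -[in RHS](finset.setD1K pJ).
  have -> : kalg_coef (p |: J :\ p) z = kalg_coef (J :\ p) b.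
    by rewrite kalg_ofE !inE eqxx.
  rewrite -dc' !kdE [RHS](bigD1 p) /= ?inE ?eqxx //.
  rewrite finset.setD1K // (c'_supp J p) // mulr0 add0r.
  apply: eq_big => [j|j jJ].
    by rewrite !inE negb_and negbK; case: eqP => [->|]; rewrite ?pJ ?andbT.
  have jp : j != p by apply: contraNneq jJ => ->.
  rewrite kalg_ofE !inE pJ orbT.
  have -> : (j |: J) :\ p = j |: J :\ p.
    by apply/finset.setP=> i; rewrite !inE; case: (i =P j) => [->|] //; rewrite jp.
  have [jk|kj] := ltnP j k; first by rewrite ksignD1 //= ltnNge (ltnW jk) mul1r.
  by rewrite [kalg_coef _ c'](c'_supp _ j) ?mulr0 // !inE eqxx.
have dw' J : p \notin J ->
    kalg_coef J (kd x w) = ksign R J p * tnth x p * kalg_coef J c'.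
  move=> pJ; rewrite kdE (bigD1 p) //= kalg_ofE !inE eqxx setU1K //.
  rewrite big1 ?addr0 // => j /andP[jJ jp].
  by rewrite kalg_ofE !inE eq_sym (negbTE jp) (negbTE pJ) mulr0.
(* The remainder lives on the first k variables, and its coefficient at the empty set is in the
   ideal by the choice of [s]. *)
have [|||y y_supp dy] := IHk (z - kd x w) (ltnW kd_le).
- move=> J j jJ kj; rewrite kalg_coefB.
  have [pJ|pJ] := boolP (p \in J); first by rewrite dw // subrr.
  rewrite dw' // (c'_supp _ _ jJ kj) mulr0 subr0; apply: z_supp (jJ) _.
  by apply: ltk => //; apply: contraNneq pJ => <-.
- by rewrite linearB /= kd_kd dz subrr.
- rewrite kalg_coefB dw' ?inE // c'0.
  have -> : ksign R finset.set0 p = 1.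
    by rewrite /ksign eq_card0 // => i; rewrite !inE.
  by rewrite mul1r.
exists (y + w); last by rewrite linearD /= dy subrK.
move=> J j jJ kj; rewrite kalg_coefD (w_supp _ j) // (y_supp _ j) ?addr0 //.
exact: ltnW.
Qed.

End KoszulExact.

(** * Products of families of modules *)

Section ProdModule.
Variables (R : pzRingType) (T : Type) (L : T -> lmodType R).

(** The full product rather than the direct sum, so that preimages can be chosen in each degree
    separately. *)
Definition prodmod : Type := forall i, L i.
HB.instance Definition _ := gen_eqMixin prodmod.
HB.instance Definition _ := gen_choiceMixin prodmod.

Lemma prodmodP (f g : prodmod) : (forall i, f i = g i) -> f = g.
Proof. exact: functional_extensionality_dep. Qed.

Definition prodmod0 : prodmod := fun i => 0.
Definition prodmodD (f g : prodmod) : prodmod := fun i => f i + g i.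
Definition prodmodN (f : prodmod) : prodmod := fun i => - f i.
Definition prodmodZ (a : R) (f : prodmod) : prodmod := fun i => a *: f i.

Lemma prodmodDA : associative prodmodD.
Proof. by move=> f g h; apply: prodmodP => i; exact: addrA. Qed.
Lemma prodmodDC : commutative prodmodD.
Proof. by move=> f g; apply: prodmodP => i; exact: addrC. Qed.
Lemma prodmod0D : left_id prodmod0 prodmodD.
Proof. by move=> f; apply: prodmodP => i; exact: add0r. Qed.
Lemma prodmodND : left_inverse prodmod0 prodmodN prodmodD.
Proof. by move=> f; apply: prodmodP => i; exact: addNr. Qed.
HB.instance Definition _ :=
  GRing.isZmodule.Build prodmod prodmodDA prodmodDC prodmod0D prodmodND.

Lemma prodmodZA a b f : prodmodZ a (prodmodZ b f) = prodmodZ (a * b) f.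
Proof. by apply: prodmodP => i; exact: scalerA. Qed.
Lemma prodmodZ1 : left_id 1 prodmodZ.
Proof. by move=> f; apply: prodmodP => i; exact: scale1r. Qed.
Lemma prodmodZDr : right_distributive prodmodZ +%R.
Proof. by move=> a f g; apply: prodmodP => i; exact: scalerDr. Qed.
Lemma prodmodZDl f : {morph prodmodZ^~ f : a b / a + b}.
Proof. by move=> a b; apply: prodmodP => i; exact: scalerDl. Qed.
HB.instance Definition _ := GRing.Zmodule_isLmodule.Build R prodmod
  prodmodZA prodmodZ1 prodmodZDr prodmodZDl.


End ProdModule.

(** * Coefficients of the graded Koszul complex *)

Section KoszulCoef.
Local Open Scope set_scope.
Variables (R : comNzRingType) (d : nat).

Lemma kcoef_is_scalar i (J : {set 'I_d}) :
  scalar (fun f : koszul R d i => kcoef f J).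
Proof.
move=> a f g; rewrite /kcoef; case: insub => [u|]; first by rewrite !ffunE.
by rewrite mulr0 addr0.
Qed.

Lemma kcoefZ i (J : {set 'I_d}) a (f : koszul R d i) :
  kcoef (a *: f) J = a * kcoef f J.
Proof.
by rewrite /kcoef; case: insub => [u|]; rewrite ?ffunE ?mulr0.
Qed.

Lemma kcoef_kdiff (x : d.-tuple R) i (f : koszul R d i.+1) (J : {set 'I_d}) :
  #|J| = i -> kcoef (kdiff x f) J =
    \sum_(j | j \notin J) ksign R J j * tnth x j * kcoef f (j |: J).
Proof.
move=> /eqP cJ; rewrite {1}/kcoef; case: insubP => [u _ uJ|]; last by rewrite cJ.
by rewrite ffunE uJ.
Qed.

End KoszulCoef.

Section OmegaIncl.
Variables (R : comNzRingType) (d : nat) (x : d.-tuple R) (lam : R).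

(** A map out of the cyclic module R / (x, lam) is determined by its value at 1. *)
Lemma Omega_incl_inj : injective (@Omega_incl R d x lam).
Proof.
move=> f g fg; apply: (@homP _ _ _ f g) => u.
rewrite -(rreprK u) -(mulr1 (rrepr u)).
have hE (h : Omega x lam) a :
    hom_fun h (rpi _ (a * 1)) = a *: Omega_incl h.
  by rewrite -scale_rpi /Omega_incl /hom_fun linearZ.
by rewrite !hE fg.
Qed.

Lemma Omega_inclN f : @Omega_incl R d x lam (- f) = - Omega_incl f.
Proof. by []. Qed.

End OmegaIncl.

(** * The mapping cone of the lift and its exactness *)

Section Cone.
Local Open Scope set_scope.
Variables (R : comNzRingType) (d : nat) (x : d.-tuple R) (lam : R).
Variables (L : nat -> lmodType R) (dL : forall i, {linear L i.+1 -> L i}).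
Variables (eps : {linear L 0%N -> Omega x lam}).
Variables (phi : forall i, {linear L i -> koszul R d i}).
Hypothesis xreg : forall i : 'I_d,
  ~ zero_divisor_on (rquot (take i x)) (tnth x i).
Hypothesis resL : free_resolution dL eps.
Hypothesis liftL : lifts_inclusion dL eps phi.

(** At a set of size i only the component of degree i is read, so [l] is cut off above degree d. *)
Definition total_lift (l : prodmod L) : kalg R d :=
  kalg_of (fun J => kcoef (phi #|J| (l #|J|)) J).

Lemma total_liftE l i (J : {set 'I_d}) :
  #|J| = i -> kalg_coef J (total_lift l) = kcoef (phi i (l i)) J.
Proof. by move=> <-; rewrite kalg_ofE. Qed.

Lemma total_lift_is_linear : linear total_lift.
Proof.
move=> a f g; apply: kalgP => J; rewrite kalg_coefD kalg_coefZ !kalg_ofE.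
by rewrite linearP kcoef_is_scalar.
Qed.
HB.instance Definition _ := GRing.isLinear.Build R (prodmod L) (kalg R d) *:%R
  total_lift total_lift_is_linear.

Definition total_dL (l : prodmod L) : prodmod L := fun i => dL i (l i.+1).

Lemma total_dL_is_linear : linear total_dL.
Proof. by move=> a f g; apply: prodmodP => i; rewrite /total_dL linearP. Qed.
HB.instance Definition _ := GRing.isLinear.Build R (prodmod L) (prodmod L) *:%R
  total_dL total_dL_is_linear.

Lemma kd_total_lift l : kd x (total_lift l) = total_lift (total_dL l).
Proof.
apply: kalgP => J; rewrite kdE kalg_ofE liftL.1 kcoef_kdiff //.
apply: eq_bigr => j jJ; rewrite (@total_liftE _ #|J|.+1) //.
by rewrite cardsU1 jJ.
Qed.

Definition cone : lmodType R := (kalg R d * prodmod L)%type.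

(** L_i sits in degree i + 1 of the cone; the minus sign makes the square zero, [phi] being a chain
    map. *)
Definition cone_diff (c : cone) : cone :=
  (kd x c.1 + total_lift c.2, - total_dL c.2).

Lemma cone_diff_is_linear : linear cone_diff.
Proof.
move=> a [z l] [z' l']; rewrite /cone_diff /= kd_is_linear.
rewrite total_lift_is_linear total_dL_is_linear.
congr (_, _); last by rewrite opprD -scalerN.
by rewrite addrACA -scalerDr.
Qed.
HB.instance Definition _ := GRing.isLinear.Build R cone cone *:%R
  cone_diff cone_diff_is_linear.

Lemma ideal_gen_kd0 z : ideal_gen x (kalg_coef finset.set0 (kd x z)).
Proof.
rewrite kdE; have [i0 iD iM] := ideal_gen_ideal x.
apply: (big_ind (ideal_gen x)) => // j _; rewrite mulrAC.
by apply: iM; apply/mem_ideal_gen/mem_tnth.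
Qed.

(** The second component l is a cycle of L, and eps l_0 = 0 because phi l_0 is minus a Koszul
    boundary and Omega embeds in R / x. Writing l = dL l' makes z + phi l' a Koszul cycle, hence a
    boundary. *)
Lemma cone_exact (c : cone) :
  lift_Omega x lam (kalg_coef finset.set0 c.1) -> cone_diff c = 0 ->
  exists2 w : cone, kalg_coef finset.set0 w.1 = 0 & cone_diff w = c.
Proof.
case: c => z l [f fz] [/= dz dl].
have [_ epsS ex0 exS] := resL.
have kaugE (k : prodmod L) :
    rpi x (kalg_coef finset.set0 (total_lift k)) = Omega_incl (eps (k 0%N)).
  by rewrite (@total_liftE _ 0%N) ?cards0 // -liftL.2.
have dl0 i : dL i (l i.+1) = 0.
  by apply: oppr_inj; rewrite oppr0; apply: (congr1 (fun k => k i) dl).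
have lE i : exists u, dL i u = l i.
  case: i => [|i]; last exact/exS.
  apply/ex0/Omega_incl_inj; rewrite -kaugE -[RHS]/0; apply/rpi_eq0.
  move/eqP: dz; rewrite addrC addr_eq0 => /eqP ->.
  rewrite -[- _]add0r kalg_coefB kalg_coef0 add0r -mulN1r.
  by have [_ _] := ideal_gen_ideal x; apply; apply: ideal_gen_kd0.
have [q qf] := epsS f.
(* [total_dL] leaves degree 0 of [l'] free; the value -q there cancels the class f of z in R / x. *)
pose l' : prodmod L := fun i => if i is j.+1 then sval (cid (lE j)) else - q.
have dl' : total_dL l' = l by apply: prodmodP => i; apply: svalP (cid (lE i)).
have [|||y _ dy] := @koszul_exact R d x d (z + total_lift l') xreg (leqnn d).
- by move=> J j _; rewrite leqNgt ltn_ord.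
- by rewrite linearD /= kd_total_lift dl'.
- rewrite take_oversize ?size_tuple //; apply/rpi_eq0.
  by rewrite kalg_coefD raddfD /= kaugE -fz linearN qf Omega_inclN subrr.
(* e_set0 is a cycle, so removing its multiple from y keeps the boundary. *)
exists (y - kalg_coef finset.set0 y *: kdelta R finset.set0, - l') => /=.
  by rewrite kalg_coefB kalg_coefZ kdeltaE eqxx mulr1 subrr.
rewrite /cone_diff /= linearB linearZ /= kd_kdelta0 scaler0 subr0 dy !linearN /=.
by rewrite addrK opprK dl'.
Qed.

End Cone.

(** * Comparison of two null-homotopies in the cone *)

Section LiftTop.
Local Open Scope set_scope.
Variables (R : comNzRingType) (d : nat) (x : d.-tuple R) (lam : R).
Variables (L : nat -> lmodType R) (dL : forall i, {linear L i.+1 -> L i}).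
Variables (eps : {linear L 0%N -> Omega x lam}).
Variables (phi : forall i, {linear L i -> koszul R d i}).
Hypothesis xreg : forall i : 'I_d,
  ~ zero_divisor_on (rquot (take i x)) (tnth x i).
Hypothesis resL : free_resolution dL eps.
Hypothesis liftL : lifts_inclusion dL eps phi.
Implicit Types (I J : {set 'I_d}).

Local Notation cone := (cone d L).
Local Notation D := (cone_diff x dL phi).
Local Notation coef J c := (kalg_coef J (c : cone).1).

Let coef_is_scalar J a (b c : cone) :
  coef J (a *: b + c) = a * coef J b + coef J c.
Proof. exact: kalg_coef_is_scalar. Qed.

Let coef_sum J (T : finType) (P : pred T) (F : T -> cone) :
  coef J (\sum_(i | P i) F i) = \sum_(i | P i) coef J (F i).
Proof.
apply: (big_morph (fun c : cone => coef J c)); last exact: kalg_coef0.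
by move=> b c; apply: kalg_coefD.
Qed.

Lemma coef_kbd J I (h : {set 'I_d} -> cone) : coef I (kbd x h J) =
  \sum_(j in J) ksign R J j * tnth x j * coef I (h (J :\ j)).
Proof.
by rewrite coef_sum; apply: eq_bigr => j _; apply: kalg_coefZ.
Qed.

Lemma inl_kbd (f : {set 'I_d} -> kalg R d) J :
  kbd x (fun I => (f I, 0) : cone) J = (kbd x f J, 0).
Proof.
rewrite /kbd (big_morph (fun z => (z, 0) : cone) (id1 := 0) (op1 := +%R)) //.
  by apply: eq_bigr => j _; congr (_, _); rewrite scaler0.
by move=> b c; congr (_, _); rewrite addr0.
Qed.

Lemma cone_diff_inl z : D (z, 0) = (kd x z, 0).
Proof.
rewrite /cone_diff /= (linear0 (total_lift phi)) (linear0 (total_dL dL)).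
by rewrite oppr0 addr0.
Qed.

(** In the ungraded cone, vanishing at the empty set stands in for positive degree: [kbd x h] then
    vanishes there too, so each right-hand side keeps the coefficient of [g], in Omega'. *)
Lemma cone_homotopy (s : R) (g : {set 'I_d} -> cone) :
  (forall J, lift_Omega x lam (coef finset.set0 (g J))) ->
  (forall J, D (g J) = s *: kbd x g J) ->
  exists2 h, forall J, coef finset.set0 (h J) = 0 &
    forall J, D (h J) = g J - s *: kbd x h J.
Proof.
move=> g0 gD.
apply: (@kbd_homotopy _ _ x cone D
  (fun c => lift_Omega x lam (coef finset.set0 c))
  (fun c => coef finset.set0 c = 0)) => //.
- exact: kalg_coef0.
- exact: (cone_exact xreg resL liftL).
move=> h J h0; rewrite addrC -scaleNr coef_is_scalar coef_kbd.
by rewrite big1 ?mulr0 ?add0r // => j _; rewrite h0 mulr0.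
Qed.

Lemma lift_Omega0 : lift_Omega x lam 0.
Proof. by apply/lift_OmegaE; rewrite mulr0; have [] := ideal_gen_ideal x. Qed.

(* Multiplication by an element of Omega' is null-homotopic as a map from the
   Koszul complex to the cone, the latter being a resolution of R / Omega'. *)
Lemma mul_null_homotopic u : lift_Omega x lam u ->
  exists2 h, forall J, coef finset.set0 (h J) = 0 &
    forall J, D (h J) = (u *: kdelta R J, 0) - kbd x h J.
Proof.
move=> uO.
have [|J|h h0 hD] := @cone_homotopy 1 (fun J => (u *: kdelta R J, 0)).
- move=> J; rewrite /= kalg_coefZ kdeltaE; case: eqP => _.
    by rewrite mulr1.
  by rewrite mulr0; apply: lift_Omega0.
- rewrite cone_diff_inl scale1r inl_kbd linearZ /= kd_kdelta.
  by rewrite kbdZ.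
by exists h => // J; rewrite hD scale1r.
Qed.

Lemma ktop_lift_not_in_ideal (m : set R) p :
  is_ideal m -> ~ m 1 -> (forall i, m (tnth x i)) ->
  @mulset R R^o m (lift_Omega x lam) (tnth x p) ->
  exists l, ~ m (ktop (phi d l)).
Proof.
move=> [m0 mD mM] m1 xm [k [a [u [am uO xpE]]]].
have mMr b c : m b -> m (b * c) by move=> mb; rewrite mulrC; apply: mM.
have msum (T : finType) (P : pred T) (F : T -> R) :
    (forall i, P i -> m (F i)) -> m (\sum_(i | P i) F i).
  by move=> mF; apply: (big_ind m).
have /choice[s sP] i : exists h : {set 'I_d} -> cone,
    (forall J, coef finset.set0 (h J) = 0) /\
    forall J, D (h J) = (u i *: kdelta R J, 0) - kbd x h J.
  by have [h h0 hD] := mul_null_homotopic (uO i); exists h.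
(* As x_p = \sum_i a_i u_i, this is a null-homotopy of x_p, with values in m times the cone. *)
pose sa J : cone := \sum_i a i *: s i J.
have Das J : D (sa J) = (tnth x p *: kdelta R J, 0) - kbd x sa J.
  rewrite /sa kbd_sum linear_sum.
  under eq_bigr do rewrite linearZ /= (sP _).2 scalerBr.
  rewrite big_split /= sumrN; congr (_ - _); last first.
    by apply: eq_bigr => i _; rewrite kbdZ.
  rewrite xpE scaler_suml.
  rewrite (big_morph (fun z => (z, 0) : cone) (id1 := 0) (op1 := +%R)) //.
    by apply: eq_bigr => i _; congr (_, _); rewrite ?scaler0 // scalerA.
  by move=> b c; congr (_, _); rewrite addr0.
(* Both terms are null-homotopies of x_p, so their difference anticommutes with the differentials;
   hence the sign -1 below. *)
pose t J : cone := (kwedge R p J, 0) - sa J.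
have [|J|h _ hD] := @cone_homotopy (-1) t.
- move=> J; rewrite /t addrC -scaleN1r coef_is_scalar coef_sum big1 => [|i _].
    rewrite mulr0 add0r /= /kwedge; case: ifP => _.
      by rewrite kalg_coef0; apply: lift_Omega0.
    rewrite kalg_coefZ kdeltaE eq_sym; case: eqP => [/finset.setP/(_ p)|_].
      by rewrite !inE eqxx.
    by rewrite mulr0; apply: lift_Omega0.
  by rewrite /= kalg_coefZ (sP i).1 mulr0.
- rewrite /t linearB /= Das cone_diff_inl.
  rewrite (_ : kd x _ = tnth x p *: kdelta R J - kbd x (kwedge R p) J).
    have -> : kbd x t J = (kbd x (kwedge R p) J, 0) - kbd x sa J.
      rewrite -inl_kbd -[kbd x sa J]scale1r -scaleNr -kbdZ -kbdD.
      by apply: eq_kbd => j _; rewrite scaleN1r.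
    rewrite scaleN1r opprB opprD opprK.
    rewrite (_ : (_ - _, 0) = (tnth x p *: kdelta R J, 0) -
                              (kbd x (kwedge R p) J, 0) :> cone).
      by rewrite addrC addrA addrNK addrC.
    by congr (_, _); rewrite subrr.
  by apply/eqP; rewrite eq_sym subr_eq -kd_kwedge.
(* On the complement of p, e_p /\ e_J0 is the top basis element up to sign. *)
pose J0 := [set: 'I_d] :\ p.
exists ((h J0).2 d) => mtop.
have mx I (j : 'I_d) c : m (ksign R I j * tnth x j * c).
  by apply: mMr; apply: mM.
(* At the full set the Koszul differential contributes nothing, which leaves phi_d of the component
   in L_d. *)
have := congr1 (fun c : cone => coef [set: 'I_d] c) (hD J0).
rewrite scaleN1r opprK /= !kalg_coefD kdE big1 ?add0r; last first.
  by move=> j; rewrite inE.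
rewrite (@total_liftE _ _ _ _ _ d) ?cardsT ?card_ord // => topE.
have pJ0 : p \notin J0 by rewrite !inE eqxx.
have sgnE : ksign R J0 p = ktop (phi d ((h J0).2 d))
    - coef [set: 'I_d] (kbd x h J0) + coef [set: 'I_d] (sa J0).
  rewrite /ktop topE addrK -addrA -kalg_coefD addNr kalg_coef0 addr0.
  rewrite /kwedge (negbTE pJ0) kalg_coefZ finset.setD1K ?inE // kdeltaE eqxx.
  by rewrite mulr1.
(* The sign squares to 1, so its membership in m forces 1 into m. *)
apply: m1; rewrite -(ksign_sqr R J0 p); apply: (mM); rewrite sgnE.
apply: (mD); last first.
  by rewrite coef_sum; apply: msum => i _; rewrite /= kalg_coefZ; apply: mMr.
apply: (mD) => //; rewrite -mulN1r; apply: (mM); rewrite coef_kbd.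
by apply: msum.
Qed.

End LiftTop.

(** * Surjectivity of the top component *)

Local Open Scope classical_set_scope.

Theorem mainTheorem13
    (R : comNzRingType) (m : set R) (n d : nat) (x : d.-tuple R) (lam : R)
    (L : nat -> lmodType R) (dL : forall i, {linear L i.+1 -> L i})
    (eps : {linear L 0%N -> Omega x lam})
    (phi : forall i, {linear L i -> koszul R d i})
    (hR : local_ring m) (hdim : krull_dim R n)
    (hxm : forall i, m (tnth x i)) (hx : regular_sequence x)
    (hzd : zero_divisor_on (rquot x) lam)
    (hpar : ~ parameter (rpi x @` m) (rpi x lam))
    (hL : minimal_free_resolution m dL eps)
    (hphi : lifts_inclusion dL eps phi)
    (hmem : exists i, @mulset R R^o m (lift_Omega x lam) (tnth x i)) :
  (fun l : L d => ktop (phi d l)) @` setT = setT.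
Proof.
have [resL _] := hL; have [xreg _] := hx; have [p hp] := hmem.
have [_ [mI m1 _] _] := hR.
have [l ml] := ktop_lift_not_in_ideal xreg resL hphi mI m1 hxm hp.
have [r rl] := local_ring_unit hR ml.
apply/seteqP; split=> // a _; exists ((a * r) *: l) => //.
by rewrite linearZ /= /ktop kcoefZ -/(ktop _) -mulrA rl mulr1.
Qed.
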